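(* If $1<p<\infty$ and $p<r\le q\le\infty$, then for any $\beta>r^{-1}-p^{-1}$ (with $\infty^{-1}=0$) the operator $B(x,y)=x\otimes y$ does not act from $L_{pr}\times L_{pq}$ into $L_{pq}(\log L)^{\beta}(I\times I)$; that is, there exist $x\in L_{pr}$ and $y\in L_{pq}$ with $x\otimes y\notin L_{pq}(\log L)^{\beta}(I\times I)$.
   Context: $I=[0,1]$ with Lebesgue measure. For a measurable function $z$ on $I$ or $I\times I$, $z^*$ denotes the left-continuous non-increasing rearrangement of $|z|$ on $(0,1]$. For measurable $x,y$ on $I$, $B(x,y)(s,t)=(x\otimes y)(s,t)=x(s)y(t)$. For $1<p<\infty$, $1\le q\le\infty$, $\beta\in\mathbf R$, let $\phi_{p,\beta}(u)=u^{1/p}\ln^{\beta}(e/u)$. The Lorentz–Zygmund space $L_{pq}(\log L)^{\beta}$ on $I$ (resp. $I\times I$) is the set of measurable $x$ for which $$\|x\|_{p,\beta,q}=\left\{\int_0^1(x^*(u)\phi_{p,\beta}(u))^q\,\frac{du}u\right\}^{1/q}\ (q<\infty),\qquad \|x\|_{p,\beta,\infty}=\sup_{0<u\le1}x^*(u)\phi_{p,\beta}(u)$$ is finite. The Lorentz space is $L_{pq}=L_{pq}(\log L)^0$. *)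

(* Defs.v *)
From HB Require Import structures.
From mathcomp Require Import all_boot all_order all_algebra.
From mathcomp Require Import all_classical all_reals all_analysis.

Set Implicit Arguments.
Unset Strict Implicit.
Unset Printing Implicit Defensive.

Import Order.TTheory GRing.Theory Num.Theory.
Import numFieldNormedType.Exports.

Local Open Scope classical_set_scope.
Local Open Scope ring_scope.

Section LorentzZygmund.
Context d (T : measurableType d) (R : realType).
Variables (mu : {measure set T -> \bar R}) (D : set T).

(* The strict "< u" (instead of "<= u") makes this the left-continuous
   non-increasing rearrangement of |z| (it is meant for 0 < u <= mu D). *)
Definition rearrangement (z : T -> R) (u : R) : \bar R :=
  ereal_inf [set l%:E | l in
    [set l : R | 0 <= l /\ (mu (D `&` [set t | (l < `|z t|)%R]) < u%:E)%E]].

Definition LZ_weight (p beta u : R) : R :=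
  u `^ p^-1 * ln (expR 1 / u) `^ beta.

Definition LZ_norm (p beta : R) (q : \bar R) (z : T -> R) : \bar R :=
  match q with
  | q'%:E => poweR
      (\int[lebesgue_measure]_(u in `]0%R, 1%R])
        (poweR (rearrangement z u * (LZ_weight p beta u)%:E) q' * (u^-1)%:E))
      q'^-1
  | +oo => ereal_sup
      [set (rearrangement z u * (LZ_weight p beta u)%:E)%E | u in `]0%R, 1%R]]
  | -oo => +oo (* junk value: exponents satisfy 1 <= q *)
  end%E.

Definition LZ_space (p beta : R) (q : \bar R) : set (T -> R) :=
  [set z | measurable_fun D z /\ (LZ_norm p beta q z < +oo)%E].

Definition Lorentz_space (p : R) (q : \bar R) : set (T -> R) :=
  LZ_space p 0 q.

End LorentzZygmund.

Section UnitInterval.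
Context {R : realType}.

Definition leb1 : {measure set (measurableTypeR R) -> \bar R} :=
  @lebesgue_measure R.

Definition leb2 :
    {measure set (measurableTypeR R * measurableTypeR R) -> \bar R} :=
  (@lebesgue_measure R \x @lebesgue_measure R)%E.

Definition I1 : set (measurableTypeR R) := `[0%R, 1%R].

Definition I2 : set (measurableTypeR R * measurableTypeR R) := I1 `*` I1.

Definition tensor (x y : measurableTypeR R -> R) :
    measurableTypeR R * measurableTypeR R -> R :=
  fun st => x st.1 * y st.2.

End UnitInterval.

(* Main.v *)
(* Take [x s = s^(-1/p) ln(e/s)^(-a)] and [y t = t^(-1/p) ln(e/t)^(-b)], with
   [a] and [b] slightly larger than [1/r] and [1/q].  Both are nonincreasing, so
   they lie in the required Lorentz spaces.  On the hyperbolic region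
   [s t < delta] of the square, whose measure is of order
   [delta ln(1/delta)], both logarithms are at most of order [ln(1/delta)], so
   that [x s * y t] is at least of order
   [delta^(-1/p) ln(1/delta)^(-a-b)].  The extra logarithm in the measure gives
   [(x (x) y)^* u >= C u^(-1/p) ln(1/u)^(1/p-a-b)], which is not in the target
   space as soon as [beta >= a + b - 1/p - 1/q].  Quantitatively, restricting
   the norm to [u] in [[exp(-M), exp(-M/2)]] makes it at least a positive power
   of [M]. *)
Require Import Defs.
From mathcomp Require Import all_boot all_order all_algebra.
From mathcomp Require Import all_classical all_reals all_analysis.
From mathcomp Require Import measurable_realfun ring lra.
Import Order.TTheory GRing.Theory Num.Theory.
Import numFieldNormedType.Exports.
Local Open Scope classical_set_scope.
Local Open Scope ring_scope.

(** * Integrals: monotonicity without measurability, and explicit primitives *)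

(** The integral of a nonnegative function is a supremum over the simple functions below it, so
    enlarging the integrand enlarges the supremum. Integrands built on [rearrangement] can thus be
    compared without showing that they are measurable. *)
Lemma ge0_le_integral_nonmeas d (T : measurableType d) (R : realType)
    (mu : {measure set T -> \bar R}) (D : set T) (f g : T -> \bar R) :
  (forall x, D x -> (0 <= f x)%E) -> (forall x, D x -> (f x <= g x)%E) ->
  (\int[mu]_(x in D) f x <= \int[mu]_(x in D) g x)%E.
Proof.
move=> f0 fg.
have g0 x : D x -> (0 <= g x)%E.
  by move=> Dx; apply: le_trans (fg _ Dx); exact: f0.
rewrite !ge0_integralE//; apply: ereal_sup_le => _ [h hf <-].
exists h => // x; apply: (le_trans (hf x)).
by rewrite /patch; case: ifPn => // /set_mem; exact: fg.
Qed.

Lemma ge0_subset_integral_nonmeas d (T : measurableType d) (R : realType)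
    (mu : {measure set T -> \bar R}) (A D : set T) (f : T -> \bar R) :
  A `<=` D -> (forall x, D x -> (0 <= f x)%E) ->
  (\int[mu]_(x in A) f x <= \int[mu]_(x in D) f x)%E.
Proof.
move=> AD f0; rewrite (integral_mkcond A) (integral_mkcond D).
apply: ge0_le_integral_nonmeas => x _; rewrite /patch.
  by case: ifPn => // /set_mem Ax; exact/f0/AD.
case: ifPn => [/set_mem Ax|_]; first by rewrite ifT// inE; exact: AD.
by case: ifPn => // /set_mem; exact: f0.
Qed.

Lemma derive_continuous_FTC2 (R : realType) (F f : R -> R) (a b : R) : a < b ->
  (forall x, a <= x <= b -> is_derive x 1 F (f x)) ->
  (forall x, a <= x <= b -> {for x, continuous f}) ->
  (\int[lebesgue_measure]_(x in `[a, b]) (f x)%:E = (F b - F a)%:E)%E.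
Proof.
move=> ab dF cf.
have cF (x : R) : a <= x <= b -> {for x, continuous F}.
  move=> /dF dFx; apply/differentiable_continuous/derivable1_diffP.
  exact: ex_derive.
rewrite (@continuous_FTC2 R f F)//.
- apply: continuous_in_subspaceT => x; rewrite inE/= in_itv/=; exact: cf.
- split.
  + move=> x; rewrite in_itv/= => /andP[ax xb].
    by have /dF dFx : a <= x <= b; [rewrite !ltW|exact: ex_derive].
  + by apply/cvg_at_right_filter/cF; rewrite lexx ltW.
  + by apply/cvg_at_left_filter/cF; rewrite lexx ltW.
- move=> x; rewrite in_itv/= => /andP[ax xb]; rewrite derive1E.
  by have /dF dFx : a <= x <= b; [rewrite !ltW|exact: derive_val].
Qed.

Lemma integral_divr (R : realType) (C a b : R) : 0 < a -> a < b ->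
  (\int[lebesgue_measure]_(x in `[a, b]) (C * x^-1)%:E =
   (C * (ln b - ln a))%:E)%E.
Proof.
move=> a0 ab; rewrite mulrBr.
apply: (@derive_continuous_FTC2 R (fun x => C * ln x)) => // x /andP[ax _].
- by apply/is_deriveZ/is_derive1_ln; exact: lt_le_trans ax.
- apply: continuousM; first exact: cst_continuous.
  by apply: inv_continuous; rewrite gt_eqF// (lt_le_trans a0).
Qed.

Lemma onemln_ge1 (R : realType) (s : R) : s <= 1 -> 1 <= 1 - ln s.
Proof. by move=> s1; rewrite lerBrDr gerDl ln_le0. Qed.

Lemma onemln_gt0 (R : realType) (s : R) : s <= 1 -> 0 < 1 - ln s.
Proof. by move/onemln_ge1; exact: lt_le_trans. Qed.

(** The primitive [F] takes values between [0] and [C / (c - 1)] on []0, 1]] because [1 < c]. This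
    bounds the integrals over the compact intervals [A n], which exhaust []0, 1]], and monotone
    convergence carries the bound to the limit. *)
Lemma integral_ln_powR_inv (R : realType) (C c : R) : 0 <= C -> 1 < c ->
  (\int[lebesgue_measure]_(u in `]0%R, 1%R])
     (C * (1 - ln u) `^ (- c) * u^-1)%:E < +oo)%E.
Proof.
move=> C0 c1.
pose f (u : R) : R := C * (1 - ln u) `^ (- c) * u^-1.
pose F (u : R) : R := C / (c - 1) * (1 - ln u) `^ (1 - c).
pose A (n : nat) : set R := `[expR (- (n.+1%:R : R)), 1]%classic.
have An n : expR (- (n.+1%:R : R)) < 1.
  by rewrite -[ltRHS]expR0 ltr_expR oppr_lt0.
have mA n : measurable (A n) by exact: measurable_itv.
have AU : \bigcup_i A i = `]0, 1]%classic.
  rewrite eqEsubset; split=> [x [n _]|x]/=.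
    rewrite /A/= !in_itv/= => /andP[nx ->]; rewrite andbT.
    exact: lt_le_trans nx.
  rewrite in_itv/= => /andP[x0 x1]; exists (Num.truncn (- ln x)) => //.
  rewrite /A/= in_itv/= x1 andbT -[leRHS](@lnK _ x)// ler_expR lerNl.
  by apply/ltW/truncnS_gt.
have dl (x : R) : 0 < x -> is_derive x 1 (fun u : R => 1 - ln u) (- x^-1).
  move=> x0; rewrite -[- _]add0r.
  by apply: is_deriveB; exact: is_derive1_ln.
have dF (x : R) : 0 < x <= 1 -> is_derive x 1 F (f x).
  move=> /andP[x0 /onemln_gt0 l0].
  have dp :=
    @is_derive1_comp _ _ _ x _ _ (is_derive1_powR (1 - c) l0) (dl _ x0).
  apply: (is_derive_eq (is_deriveZ (C / (c - 1)) dp)).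
  rewrite /f /GRing.scale/= (_ : 1 - c - 1 = - c); last by ring.
  have c10 : c - 1 != 0 by rewrite gt_eqF// subr_gt0.
  by field; rewrite c10 gt_eqF.
have cf (x : R) : 0 < x <= 1 -> {for x, continuous f}.
  move=> /andP[x0 /onemln_gt0 l0].
  apply: continuousM; last by apply: inv_continuous; rewrite gt_eqF.
  have dp := @is_derive1_comp _ _ _ x _ _ (is_derive1_powR (- c) l0) (dl _ x0).
  apply: continuousM; first exact: cst_continuous.
  by apply/differentiable_continuous/derivable1_diffP; exact: ex_derive.
have A01 (n : nat) (x : R) : expR (- (n.+1%:R : R)) <= x <= 1 -> 0 < x <= 1.
  by move=> /andP[nx ->]; rewrite (lt_le_trans _ nx)// expR_gt0.
have If n : (\int[lebesgue_measure]_(u in A n) (f u)%:E <= (C / (c - 1))%:E)%E.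
  have -> : (\int[lebesgue_measure]_(u in A n) (f u)%:E =
             (F 1 - F (expR (- (n.+1%:R : R))))%:E)%E.
    apply: derive_continuous_FTC2 => // x /(A01 n); [exact: dF|exact: cf].
  rewrite lee_fin /F ln1 subr0 powR1 mulr1 gerBl.
  rewrite mulr_ge0 ?powR_ge0// divr_ge0//.
  by rewrite subr_ge0 ltW.
have f0 x : `]0%R, 1%R]%classic x -> 0 <= f x.
  rewrite /= in_itv/= => /andP[x0 _].
  by rewrite !mulr_ge0 ?powR_ge0// invr_ge0 ltW.
rewrite -AU; apply: (@le_lt_trans _ _ (C / (c - 1))%:E); last exact: ltry.
pose mu : {measure set _ -> \bar R} := @lebesgue_measure R.
have cvgA : (\int[mu]_(u in A i) (f u)%:E @[i --> \oo] -->
             \int[mu]_(u in \bigcup_i A i) (f u)%:E)%E.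
  apply: ge0_nondecreasing_set_cvg_integral => //=.
  - apply/nondecreasing_seqP => n; apply/subsetPset => x.
    rewrite /A/= !in_itv/= => /andP[nx ->]; rewrite andbT (le_trans _ nx)//.
    by rewrite ler_expR lerN2 ler_nat.
  - move=> i; apply/measurable_EFinP.
    apply: subspace_continuous_measurable_fun => //.
    apply: continuous_in_subspaceT => x.
    by rewrite inE /A/= in_itv/= => /A01; exact: cf.
  - by move=> i x Ax; rewrite lee_fin f0// -AU; exists i.
rewrite -(cvg_lim _ cvgA)//; apply: lime_le.
  by apply/cvg_ex; eexists; exact: cvgA.
by apply: nearW => n; exact: If.
Qed.

(** * Bounds on the rearrangement through superlevel sets *)

Section rearrangement.
Context d (T : measurableType d) (R : realType).
Variables (mu : {measure set T -> \bar R}) (D : set T).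

Lemma rearrangement_ge0 (z : T -> R) (u : R) :
  (0 <= rearrangement mu D z u)%E.
Proof. by apply/ereal_infP => _ [l [l0 _] <-]; rewrite lee_fin. Qed.

Lemma rearrangement_le (z : T -> R) (u l : R) : 0 <= l ->
  (mu (D `&` [set t | l < `|z t|]%R) < u%:E)%E ->
  (rearrangement mu D z u <= l%:E)%E.
Proof. by move=> l0 lu; apply: ge_ereal_inf; exists l%:E => //; exists l. Qed.

Lemma rearrangement_ge (z : T -> R) (u l : R) :
  (forall l', l' < l -> (u%:E <= mu (D `&` [set t | l' < `|z t|]%R))%E) ->
  (l%:E <= rearrangement mu D z u)%E.
Proof.
move=> ul; apply/ereal_infP => _ [l' [_ l'u] <-]; rewrite lee_fin leNgt.
by apply/negP => /ul; rewrite leNgt l'u.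
Qed.

Lemma measurable_superlevel (z : T -> R) (l : R) :
  measurable D -> measurable_fun D z ->
  measurable (D `&` [set t | l < `|z t|]).
Proof.
move=> mD mz.
have mn : measurable_fun D (fun t => `|z t|) by exact: measurableT_comp.
have -> : [set t | l < `|z t|] = (fun t => `|z t|) @^-1` `]l, +oo[%classic.
  by apply/seteqP; split=> t /=; rewrite in_itv/= andbT.
exact: mn.
Qed.

End rearrangement.

(** * The one-variable functions and their membership in Lorentz spaces *)

(** For [s] in []0, 1]], [1 - ln s] is ln(e/s), the logarithm that occurs in [LZ_weight]. *)
Definition logpow (R : realType) (k a s : R) : R :=
  s `^ (- k) * (1 - ln s) `^ (- a).

Section logpow.
Context (R : realType).
Implicit Types k a s u : R.

Lemma logpow_ge0 k a s : 0 <= logpow R k a s.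
Proof. by rewrite mulr_ge0 ?powR_ge0. Qed.

Lemma measurable_logpow k a :
  measurable_fun [set: measurableTypeR R] (logpow R k a).
Proof.
apply: measurable_funM; first exact: measurable_powR.
apply: (measurableT_comp (measurable_powR (- a))).
exact: measurable_funB.
Qed.

(** In logarithms the claim is [a * (ln (1 - ln s) - ln (1 - ln t)) <= k * (ln t - ln s)]. It holds
    because [ln] is 1-Lipschitz on [[1, +oo[] and [a <= k]. *)
Lemma logpow_nonincreasing k a s t : 0 <= a <= k -> 0 < s -> s <= t -> t <= 1 ->
  logpow R k a t <= logpow R k a s.
Proof.
move=> /andP[a0 ak] s0 st t1.
have t0 : 0 < t by exact: lt_le_trans st.
have ls : ln s <= ln t by rewrite ler_ln.
have lt0 : 0 <= - ln t by rewrite oppr_ge0 ln_le0.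
have ps : 0 < 1 - ln s by apply: onemln_gt0; exact: le_trans t1.
have pt : 0 < 1 - ln t by exact: onemln_gt0.
rewrite /logpow /powR !gt_eqF// -!expRD ler_expR.
have le1 : ln (1 - ln s) - ln (1 - ln t) <= ln t - ln s.
  rewrite -ln_div ?posrE//.
  have -> : (1 - ln s) / (1 - ln t) = 1 + (ln t - ln s) / (1 - ln t).
    by field; rewrite gt_eqF.
  have q0 : 0 <= (ln t - ln s) / (1 - ln t).
    by apply: divr_ge0; [rewrite subr_ge0|exact: ltW].
  apply: (@le_trans _ _ ((ln t - ln s) / (1 - ln t))).
    by apply: le_ln1Dx; rewrite (lt_le_trans _ q0)// oppr_lt0.
  by rewrite ler_pdivrMr// ler_peMr ?onemln_ge1// subr_ge0.
have := ler_wpM2l a0 le1.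
have : a * (ln t - ln s) <= k * (ln t - ln s) by rewrite ler_wpM2r ?subr_ge0.
lra.
Qed.

(** Halving the argument multiplies the power by [2 ^ k] and can only shrink the logarithmic
    factor. *)
Lemma logpow_half k a u : 0 <= k -> 0 <= a -> 0 < u <= 1 ->
  logpow R k a (u / 2) <= 2 `^ k * logpow R k a u.
Proof.
move=> k0 a0 /andP[u0 u1].
rewrite /logpow powRM ?invr_ge0 ?(ltW u0)// -powR_inv1// -powRrM mulN1r opprK.
rewrite mulrA [_ * 2 `^ k]mulrC ler_wpM2l ?mulr_ge0 ?powR_ge0//.
have lu : 1 - ln u <= 1 - ln (u * 2 `^ (-1)).
  rewrite lerB// ler_ln ?posrE ?mulr_gt0 ?powR_gt0//.
  by rewrite powR_inv1// ler_piMr ?(ltW u0)// invf_le1// ler1n.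
have p0 := onemln_gt0 _ _ u1.
rewrite !(powRN _ a) lef_pV2 ?posrE ?powR_gt0//; last exact: lt_le_trans p0 lu.
by rewrite ge0_ler_powR ?nnegrE// ltW// (lt_le_trans p0).
Qed.

(** By monotonicity the level [logpow R k a (u / 2)] is exceeded only inside [[0, u / 2]]; the point
    [0], where [logpow] has a default value, lies there anyway. Taking [u / 2] instead of [u]
    secures the strict inequality in [rearrangement], at the cost of the factor [2 ^ k]. *)
Lemma rearrangement_logpow k a u : 0 <= a <= k -> 0 < u <= 1 ->
  (rearrangement leb1 I1 (logpow R k a) u <= (2 `^ k * logpow R k a u)%:E)%E.
Proof.
move=> ak u01; have /andP[u0 u1] := u01; have /andP[a0 ak'] := ak.
apply: (@le_trans _ _ (logpow R k a (u / 2))%:E); last first.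
  by rewrite lee_fin logpow_half// (le_trans a0).
have uh0 : 0 < u / 2 by rewrite divr_gt0.
apply: rearrangement_le; first exact: logpow_ge0.
apply: (@le_lt_trans _ _ (lebesgue_measure (`[0, u / 2]%classic : set R))).
  apply: le_measure; rewrite ?inE//.
  - apply: measurable_superlevel; first exact: measurable_itv.
    exact: measurable_funTS (measurable_logpow k a).
  - move=> s []; rewrite /I1/= !in_itv/= => /andP[s0 s1] ls; rewrite s0/= leNgt.
    apply/negP => us; move: ls.
    rewrite ger0_norm ?logpow_ge0// ltNge => /negP; apply.
    by apply: logpow_nonincreasing => //; exact: ltW.
rewrite lebesgue_measure_itv/= lte_fin uh0 oppr0 adde0 lte_fin.
by rewrite ltr_pdivrMr// ltr_pMr// ltr1n.
Qed.

(** The weight cancels the power of [u] and leaves a multiple of [(1 - ln u) ^ (- a)]. For finite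
    [r] its [r]-th power is integrable against du/u since [a * r > 1]; for [r = +oo] it is
    bounded. *)
Lemma Lorentz_logpow (p : R) (r : \bar R) a : 0 < p -> (0 < r)%E ->
  0 <= a <= p^-1 -> (r^-1 < a%:E)%E ->
  Lorentz_space leb1 I1 p r (logpow R p^-1 a).
Proof.
move=> p0 r0 ap ra; have /andP[a0 ap'] := ap; split.
  exact: measurable_funTS (measurable_logpow _ _).
have k0 : 0 <= p^-1 by exact: le_trans ap'.
have bound u : 0 < u <= 1 ->
    (rearrangement leb1 I1 (logpow R p^-1 a) u * (LZ_weight p 0 u)%:E <=
     (2 `^ p^-1 * (1 - ln u) `^ (- a))%:E)%E.
  move=> u01; have /andP[u0 _] := u01.
  rewrite /LZ_weight powRr0 mulr1.
  apply: le_trans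
  (lee_wpmul2r _ (rearrangement_logpow _ _ _ ap u01)) _.
    by rewrite lee_fin powR_ge0.
  rewrite -EFinM lee_fin /logpow -!mulrA ler_wpM2l ?powR_ge0//.
  by rewrite mulrCA (powRN u) mulVf ?mulr1// gt_eqF// powR_gt0.
case: r r0 ra => [r| |]// r0 ra; rewrite /LZ_norm.
- apply: poweR_lty.
  rewrite lte_fin in r0; rewrite inver gt_eqF// lte_fin in ra.
  have ar1 : 1 < a * r by rewrite -ltr_pdivrMr// div1r.
  apply: le_lt_trans
    (integral_ln_powR_inv _ ((2 `^ p^-1) `^ r) _ _ ar1); last first.
    exact: powR_ge0.
  apply: ge0_le_integral_nonmeas => u /=; rewrite in_itv/= => u01;
    have /andP[u0 u1] := u01; have u0V : (0 <= (u^-1)%:E :> \bar R)%E.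
    by rewrite lee_fin invr_ge0 ltW.
    by rewrite mule_ge0// poweR_ge0.
    by rewrite lee_fin invr_ge0 ltW.
  rewrite [X in (_ <= X)%E]EFinM. apply: lee_wpmul2r => //.
  have := bound _ u01; move=> bu.
  apply: le_trans (gt0_ler_poweR (ltW r0) _ _ bu) _.
  + rewrite in_itv/= leey andbT mule_ge0 ?rearrangement_ge0//.
    by rewrite lee_fin mulr_ge0 ?powR_ge0.
  + by rewrite in_itv/= leey andbT lee_fin mulr_ge0 ?powR_ge0.
  rewrite poweR_EFin lee_fin powRM ?powR_ge0// -!powRrM.
  by rewrite mulNr.
- apply: (@le_lt_trans _ _ (2 `^ p^-1)%:E); last exact: ltry.
  apply/ereal_supP => _ [u /= + <-]; rewrite in_itv/= => u01.
  apply: le_trans (bound _ u01) _; rewrite lee_fin ler_piMr ?powR_ge0//.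
  have /andP[u0 u1] := u01.
  rewrite powRN invf_le1 ?powR_gt0 ?onemln_gt0//.
  by rewrite -[leLHS](powRr0 (1 - ln u)) ler_powR// onemln_ge1.
Qed.

End logpow.

(** * Lower bounds for the rearrangement of the tensor product *)

Section tensor_logpow.
Context (R : realType).
Implicit Types k a b u M : R.

Lemma measurable_tensor (x y : measurableTypeR R -> R) :
  measurable_fun setT x -> measurable_fun setT y ->
  measurable_fun setT (tensor x y).
Proof.
move=> mx my; apply: measurable_funM.
- exact: measurableT_comp mx measurable_fst.
- exact: measurableT_comp my measurable_snd.
Qed.

(** Used with [e = c] to replace a logarithm by an upper bound, and with [c = beta0], [e = beta] to
    treat a weight exponent of either sign. *)
Lemma ler_powR_npos (s t c e : R) : 0 < s -> s <= t -> c <= 0 -> c <= e ->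
  1 <= s -> t `^ c <= s `^ e.
Proof.
move=> s0 st c0 ce s1; apply: (@le_trans _ _ (s `^ c)); last exact: ler_powR.
have t0 : 0 < t by exact: lt_le_trans st.
rewrite -[c]opprK !(powRN _ (- c)) lef_pV2 ?posrE ?powR_gt0//.
by rewrite ge0_ler_powR ?nnegrE ?oppr_ge0// ltW.
Qed.

Lemma logpow_tensor_ge k a b (delta N s t : R) :
  0 <= k -> 0 <= a -> 0 <= b -> 0 < s <= 1 -> 0 < t <= 1 -> s * t <= delta ->
  1 - ln s <= N -> 1 - ln t <= N ->
  delta `^ (- k) * N `^ (- (a + b)) <= logpow R k a s * logpow R k b t.
Proof.
move=> k0 a0 b0 /andP[s0 s1] /andP[t0 t1] std sN tN.
have ls := onemln_ge1 _ _ s1; have lt := onemln_ge1 _ _ t1.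
have N0 : 0 < N by apply: lt_le_trans sN; exact: lt_le_trans ls.
have d0 : 0 < delta by apply: lt_le_trans std; rewrite mulr_gt0.
have nz : (- a + - b == 0) ==> (N != 0) by apply/implyP => _; rewrite gt_eqF.
rewrite /logpow mulrACA. rewrite -powRM ?(ltW s0) ?(ltW t0)// opprD (powRD nz).
apply: ler_pM; [by rewrite powR_ge0|by rewrite mulr_ge0 ?powR_ge0| |].
  rewrite !powRN lef_pV2 ?posrE ?powR_gt0 ?mulr_gt0//.
  by rewrite ge0_ler_powR ?nnegrE ?mulr_ge0 ?(ltW s0) ?(ltW t0) ?(ltW d0).
apply: ler_pM; rewrite ?powR_ge0//.
- by apply: ler_powR_npos; rewrite ?oppr_le0// (lt_le_trans _ ls).
- by apply: ler_powR_npos; rewrite ?oppr_le0// (lt_le_trans _ lt).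
Qed.

(* The superlevel set contains [{delta <= s <= 1, delta / 2 < s * t < delta}],
   where both logarithms are at most [N] and whose slice over [s] has length
   [delta / (2 s)]. *)
Lemma leb2_superlevel_tensor k a b (delta N l : R) :
  0 <= k -> 0 <= a -> 0 <= b -> 0 < delta < 1 -> 1 - ln (delta / 2) <= N ->
  l < delta `^ (- k) * N `^ (- (a + b)) ->
  ((delta / 2 * - ln delta)%:E <=
   leb2 (I2 `&` [set st | l < `|tensor (logpow R k a) (logpow R k b) st|]%R))%E.
Proof.
move=> k0 a0 b0 /andP[d0 d1] dN lN.
set A := I2 `&` _.
have mA : measurable A.
  apply: measurable_superlevel.
    by apply: measurableX; exact: measurable_itv.
  apply: measurable_funTS.
  by apply: measurable_tensor; exact: measurable_logpow.
have -> : (delta / 2 * - ln delta)%:E =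
    (\int[lebesgue_measure]_(s in `[delta, 1%R]) (delta / 2 * s^-1)%:E)%E.
  by rewrite integral_divr// ln1 sub0r.
(* By definition [leb2 A] integrates the lengths of the slices of [A] over the whole line; keeping
   only [s] in [[delta, 1]] gives a lower bound. *)
apply: (@le_trans _ _ (\int[lebesgue_measure]_(s in `[delta, 1%R])
    (lebesgue_measure (xsection A s)))%E); last first.
  exact: ge0_subset_integral_nonmeas.
apply: ge0_le_integral_nonmeas => s /=; rewrite in_itv/= => /andP[ds s1].
  by rewrite lee_fin mulr_ge0 ?divr_ge0 ?invr_ge0 ?ltW// (lt_le_trans d0).
have s0 : 0 < s by exact: lt_le_trans ds.
pose J : set R := `]delta / 2 * s^-1, delta * s^-1[%classic.
have J0 : 0 < delta / 2 * s^-1 by rewrite mulr_gt0 ?divr_gt0 ?invr_gt0.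
have JE : lebesgue_measure J = (delta / 2 * s^-1)%:E.
  rewrite lebesgue_measure_itv/= lte_fin ifT; last first.
    by rewrite ltr_pM2r ?invr_gt0// ltr_pdivrMr// ltr_pMr// ltr1n.
  by rewrite -EFinB; congr EFin; field; rewrite gt_eqF.
rewrite -JE; apply: le_measure; rewrite ?inE.
- exact: measurable_itv.
- exact: measurable_xsection.
move=> t; rewrite /J/= in_itv/= => /andP[tl tu].
have t0 : 0 < t by exact: lt_trans tl.
have tl' : delta / 2 < s * t by rewrite [s * t]mulrC -ltr_pdivrMr.
have tu' : s * t < delta by rewrite [s * t]mulrC -ltr_pdivlMr.
(* The restriction [delta <= s] keeps the slice inside the unit interval. As [s] and [t] are at most
   [1] and [delta / 2 < s * t], both are at least [delta / 2], which bounds their logarithms by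
   [N]. *)
have t1 : t <= 1.
  by apply: (le_trans (ltW tu)); rewrite ler_pdivrMr// mul1r.
have dh0 : 0 < delta / 2 by rewrite divr_gt0.
have dhs : delta / 2 <= s.
  by apply: le_trans ds; rewrite ler_pdivrMr// ler_peMr ?ler1n// ltW.
have dht : delta / 2 <= t.
  by apply: (le_trans (ltW tl')); rewrite ler_piMl// ltW.
rewrite /xsection/= inE; split.
  by rewrite /I2 /I1/=; split; rewrite in_itv/= ltW.
rewrite /= ger0_norm ?mulr_ge0 ?powR_ge0//.
apply: lt_le_trans lN _.
apply: logpow_tensor_ge => //; rewrite ?s0 ?t0 ?(ltW tu')//.
- by apply: le_trans dN; rewrite lerD2l lerN2 ler_ln.
- by apply: le_trans dN; rewrite lerD2l lerN2 ler_ln.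
Qed.

(* For [delta = 4 u / M] the superlevel set has measure at least
   [delta / 2 * (M / 2) = u]. *)
Lemma rearrangement_tensor_ge k a b M u : 0 <= k -> 0 <= a -> 0 <= b ->
  4 <= M -> M / 2 <= - ln u <= M -> 0 < u ->
  (((4 * u / M) `^ (- k) * (3 * M) `^ (- (a + b)))%:E <=
   rearrangement leb2 I2 (tensor (logpow R k a) (logpow R k b)) u)%E.
Proof.
move=> k0 a0 b0 M4 /andP[uM1 uM2] u0.
have M0 : 0 < M by exact: lt_le_trans M4.
have u1 : u < 1 by rewrite -ltr_ln ?posrE// ln1; lra.
set delta := 4 * u / M.
have d0 : 0 < delta by rewrite divr_gt0// mulr_gt0.
have d1 : delta < 1.
  rewrite ltr_pdivrMr// mul1r; apply: lt_le_trans M4.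
  by rewrite gtr_pMr.
(* These estimates yield [M / 2 <= - ln u <= - ln delta], as [4 <= M], and [1 - ln (delta / 2) <= 1
   + M + ln M <= 3 * M], which is the origin of the constant [3]. *)
have lM : ln M < M by exact: ln_sublinear.
have l4M : ln 4 <= ln M by rewrite ler_ln ?posrE.
have l24 : ln 2 <= ln 4 :> R by rewrite ler_ln ?posrE// ler_nat.
have ld : ln delta = ln 4 + ln u - ln M.
  by rewrite ln_div ?posrE ?mulr_gt0// lnM ?posrE.
apply: rearrangement_ge => l ll.
apply: le_trans
  (@leb2_superlevel_tensor k a b delta (3 * M) l _ _ _ _ _ _) => //.
- rewrite lee_fin (_ : u = delta / 2 * (M / 2)); last first.
    by rewrite /delta; field; rewrite gt_eqF.
  by rewrite ler_pM2l ?(divr_gt0 d0)// ld; lra.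
- by rewrite d0.
- by rewrite ln_div ?posrE// ld; lra.
Qed.

(** The weight cancels [u ^ (- k)] with [k = p^-1], and the division by [M] in [4 * u / M] leaves
    the gain [M ^ k]. Since [beta0 <= 0], the upper bound [1 - ln u <= 3 * M] suffices to bound the
    logarithmic weight from below. *)
Lemma weighted_rearrangement_tensor_ge (p beta beta0 a b M u : R) :
  0 < p -> 0 <= a -> 0 <= b -> beta0 <= 0 -> beta0 <= beta ->
  4 <= M -> M / 2 <= - ln u <= M -> 0 < u ->
  ((4 `^ (- p^-1) * 3 `^ (beta0 - a - b) * M `^ (p^-1 - a - b + beta0))%:E <=
   rearrangement leb2 I2 (tensor (logpow R p^-1 a) (logpow R p^-1 b)) u *
     (LZ_weight p beta u)%:E)%E.
Proof.
move=> p0 a0 b0 bb0 bb M4 uM u0; have /andP[uM1 uM2] := uM.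
have M0 : 0 < M by exact: lt_le_trans M4.
have k0 : 0 <= p^-1 by rewrite invr_ge0 ltW.
set k := p^-1 in k0 *.
have w0 : 0 <= LZ_weight p beta u by rewrite mulr_ge0 ?powR_ge0.
apply: le_trans
  (lee_wpmul2r _ (rearrangement_tensor_ge _ _ _ _ _ k0 a0 b0 M4 uM u0)); last first.
  by rewrite lee_fin.
rewrite -EFinM lee_fin /LZ_weight -/k.
have -> : ln (expR 1 / u) = 1 - ln u by rewrite ln_div ?posrE ?expR_gt0// expRK.
have wL : (3 * M) `^ beta0 <= (1 - ln u) `^ beta.
  by apply: ler_powR_npos => //; lra.
apply: (@le_trans _ _ ((4 * u / M) `^ (- k) * (3 * M) `^ (- (a + b)) *
    (u `^ k * (3 * M) `^ beta0))); last first.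
  by rewrite ler_wpM2l ?mulr_ge0 ?powR_ge0// ler_wpM2l ?powR_ge0.
rewrite le_eqVlt; apply/orP; left; apply/eqP.
have nz (x e1 e2 : R) : 0 < x -> (e1 + e2 == 0) ==> (x != 0).
  by move=> x0; apply/implyP => _; rewrite gt_eqF.
rewrite (_ : 4 * u / M = 4 * u * M `^ (-1)) ?powR_inv1 ?(ltW M0)//.
rewrite -mulrA !powRM ?mulr_ge0 ?powR_ge0 ?invr_ge0 ?ltW//.
rewrite -powR_inv1 ?(ltW M0)//.
rewrite -powRrM mulN1r opprK.
rewrite (_ : k - a - b + beta0 = k + (- (a + b) + beta0)); last by ring.
rewrite (_ : beta0 - a - b = - (a + b) + beta0); last by ring.
rewrite (powRD (nz M _ _ M0)) !(powRD (nz _ _ (beta0) _))//.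
rewrite [u `^ - k]powRN.
have := powR_gt0 k u0 => /gt_eqF uk.
by field; rewrite uk.
Qed.

(** * Blow-up of the Lorentz-Zygmund norm *)

Lemma powR_unbounded (c e N : R) : 0 < c -> 0 < e ->
  exists2 M, 4 <= M & N < c * M `^ e.
Proof.
move=> c0 e0; exists (Num.max 4 (((`|N| + 1) / c) `^ e^-1)).
  by rewrite le_max lexx.
set M0 := _ `^ e^-1.
apply: (@lt_le_trans _ _ (c * M0 `^ e)); last first.
  rewrite ler_pM2l// ge0_ler_powR ?(ltW e0)// ?nnegrE ?powR_ge0//.
  - by rewrite le_max powR_ge0 orbT.
  - by rewrite le_max lexx orbT.
rewrite -powRrM mulVf ?gt_eqF// powRr1 ?divr_ge0 ?ltW ?addr_ge0//.
by rewrite mulrC divfK ?gt_eqF// (le_lt_trans (ler_norm N))// ltrDl.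
Qed.

(** For finite [q], the interval [[exp(-M), exp(-M/2)]] has du/u-mass [M / 2] and the weighted
    rearrangement is at least [c * M ^ g] on it, so the integral is at least a constant times
    [M ^ (g * q + 1)]. For [q = +oo] the single point [exp(-M)] gives [c * M ^ g]. The hypothesis on
    [a + b] says exactly that [g + 1/q > 0], so either bound is unbounded in [M]. *)
Lemma tensor_logpow_notin (p beta beta0 : R) (q : \bar R) a b :
  0 < p -> (0 < q)%E -> 0 <= a -> 0 <= b -> beta0 <= 0 -> beta0 <= beta ->
  ((a + b - p^-1 - beta0)%:E < q^-1)%E ->
  ~ LZ_space leb2 I2 p beta q (tensor (logpow R p^-1 a) (logpow R p^-1 b)).
Proof.
move=> p0 q0 a0 b0 bb0 bb abq [_].
set z := tensor _ _.
set c := 4 `^ (- p^-1) * 3 `^ (beta0 - a - b).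
have c0 : 0 < c by rewrite mulr_gt0 ?powR_gt0.
set g := p^-1 - a - b + beta0.
pose W u := (rearrangement leb2 I2 z u * (LZ_weight p beta u)%:E)%E.
have W0 u : (0 <= W u)%E.
  by rewrite mule_ge0 ?rearrangement_ge0// lee_fin mulr_ge0 ?powR_ge0.
have cW M u : 4 <= M -> M / 2 <= - ln u <= M -> 0 < u ->
    ((c * M `^ g)%:E <= W u)%E.
  by move=> M4 uM u0; exact: weighted_rearrangement_tensor_ge.
case: q q0 abq => [q| |]// q0 abq; rewrite /LZ_norm.
- rewrite lte_fin in q0; rewrite inver gt_eqF// lte_fin in abq.
  have qi0 : q^-1 != 0 by rewrite gt_eqF// invr_gt0.
  move/(lty_poweRy qi0); set S := (\int[_]_(_ in _) _)%E => Sy.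
  have Sge M : 4 <= M -> ((c `^ q / 2 * M `^ (g * q + 1))%:E <= S)%E.
    move=> M4; have M0 : 0 < M by exact: lt_le_trans M4.
    have hM : expR (- M) < expR (- (M / 2)) by rewrite ltr_expR; lra.
    have -> : c `^ q / 2 * M `^ (g * q + 1) =
              (c * M `^ g) `^ q * (ln (expR (- (M / 2))) - ln (expR (- M))).
      rewrite !expRK powRM ?powR_ge0 ?(ltW c0)// -powRrM powRD; last first.
        by apply/implyP => _; rewrite gt_eqF.
      by rewrite powRr1 ?(ltW M0)//; field.
    rewrite -integral_divr ?expR_gt0//.
    pose D : set R := `[expR (- M), expR (- (M / 2))]%classic.
    have D01 : D `<=` `]0, 1]%classic.
      move=> u; rewrite /D/= !in_itv/= => /andP[uM uM2].
      rewrite (lt_le_trans _ uM) ?expR_gt0//= (le_trans uM2)//.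
      by rewrite -[leRHS]expR0 ler_expR; lra.
    apply: (@le_trans _ _ (\int[lebesgue_measure]_(u in D)
        (poweR (W u) q * (u^-1)%:E))%E); last first.
      apply: ge0_subset_integral_nonmeas => //.
      move=> u; rewrite /= in_itv/= => /andP[u0 _].
      by rewrite mule_ge0 ?poweR_ge0// lee_fin invr_ge0 ltW.
    apply: ge0_le_integral_nonmeas => u Du.
      have := D01 _ Du; rewrite /= in_itv/= => /andP[u0 _].
      by rewrite lee_fin mulr_ge0 ?powR_ge0// invr_ge0 ltW.
    have := D01 _ Du; rewrite /= in_itv/= => /andP[u0 u1].
    rewrite EFinM; apply: lee_wpmul2r; first by rewrite lee_fin invr_ge0 ltW.
    rewrite -poweR_EFin; apply: gt0_ler_poweR; rewrite ?(ltW q0)//.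
    + by rewrite in_itv/= leey lee_fin mulr_ge0 ?powR_ge0// ltW.
    + by rewrite in_itv/= leey andbT; exact: W0.
    apply: cW => //; move: Du; rewrite /D/= in_itv/= => /andP[uM uM2].
    have lM : - M <= ln u by rewrite -[leLHS]expRK ler_ln// posrE expR_gt0.
    have lM2 : ln u <= - (M / 2).
      by rewrite -[leRHS]expRK ler_ln// posrE expR_gt0.
    by apply/andP; split; lra.
  have e0 : 0 < g * q + 1.
    move: abq; rewrite -[q^-1]div1r ltr_pdivlMr// /g; lra.
  have S0 : (0 <= S)%E.
    by apply: le_trans (Sge 4 _); rewrite ?lee_fin ?mulr_ge0 ?powR_ge0.
  have cq0 : 0 < c `^ q / 2 by rewrite divr_gt0 ?powR_gt0.
  have [M M4] := powR_unbounded _ _ (fine S) cq0 e0.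
  rewrite ltNge => /negP; apply.
  by rewrite -lee_fin fineK ?Sge// ge0_fin_numE.
- set S := ereal_sup _ => Sy; rewrite invey lte_fin in abq.
  have Sge M : 4 <= M -> ((c * M `^ g)%:E <= S)%E.
    move=> M4; have M0 : 0 < M by exact: lt_le_trans M4.
    apply: le_trans (cW M (expR (- M)) M4 _ (expR_gt0 _)) _.
      by rewrite expRK; apply/andP; split; lra.
    apply: ereal_sup_ubound; exists (expR (- M)) => //=.
    by rewrite in_itv/= expR_gt0 -expR0 ler_expR oppr_le0 ltW.
  have e0 : 0 < g by rewrite /g; lra.
  have S0 : (0 <= S)%E.
    by apply: le_trans (Sge 4 _); rewrite ?lee_fin ?mulr_ge0 ?powR_ge0.
  have [M M4] := powR_unbounded c _ (fine S) c0 e0.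
  rewrite ltNge => /negP; apply.
  by rewrite -lee_fin fineK ?Sge// ge0_fin_numE.
Qed.

End tensor_logpow.

Theorem theorem2p5 (R : realType) (p : R) (r q : \bar R) (beta : R)
    (hp : 1 < p) (hpr : (p%:E < r)%E) (hrq : (r <= q)%E)
    (hbeta : (r^-1 - (p%:E)^-1 < beta%:E)%E) :
  exists x y : measurableTypeR R -> R,
    [/\ Lorentz_space leb1 I1 p r x,
        Lorentz_space leb1 I1 p q y &
        ~ LZ_space leb2 I2 p beta q (tensor x y)].
Proof.
have p0 : 0 < p by exact: lt_trans hp.
have r0 : (0 < r)%E by apply: lt_trans hpr; rewrite lte_fin.
have q0 : (0 < q)%E by exact: lt_le_trans hrq.
(* All inverses of exponents are finite, with [0] for [+oo], so the comparison of exponents takes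
   place in [R]. *)
have fV (s : \bar R) : (0 < s)%E -> (s^-1)%E = (fine s^-1)%:E.
  move=> s0; rewrite fineK// fin_numV//; first by rewrite gt_eqF.
  by rewrite gt_eqF// (lt_trans _ s0).
have pV : ((p%:E)^-1)%E = (p^-1)%:E by rewrite inver gt_eqF.
set rho := fine r^-1; set theta := fine q^-1.
have rhoE : (r^-1)%E = rho%:E by exact: fV.
have thetaE : (q^-1)%E = theta%:E by exact: fV.
have theta0 : 0 <= theta by rewrite -lee_fin -thetaE inve_ge0 ltW.
have theta_rho : theta <= rho.
  by rewrite -lee_fin -thetaE -rhoE lee_pV2// inE ltW.
have rho_p : rho < p^-1.
  by rewrite -lte_fin -rhoE -pV lte_pV2// inE ltW// lte_fin.
move: hbeta; rewrite rhoE pV -EFinB lte_fin => hb.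
(* Lowering [beta] to [min(beta, 0)] makes the weight exponent nonpositive; the strict bound
   survives because [rho < p^-1]. *)
have [beta0 [b0 bb] rb0] :
    exists2 beta0, beta0 <= 0 /\ beta0 <= beta & rho - p^-1 < beta0.
  exists (Num.min beta 0); first by split; rewrite ge_min lexx ?orbT.
  by rewrite lt_min hb subr_lt0.
(* With [a = rho + eta] and [b = theta + eta], the condition [a + b - p^-1 - beta0 < theta] amounts
   to [2 * eta < beta0 + p^-1 - rho], so a third of the slack suffices. As [beta0 <= 0], it also
   keeps [a], and hence [b], at most [p^-1]. *)
pose eta := (beta0 + p^-1 - rho) / 3.
have eta0 : 0 < eta by rewrite /eta; lra.
have etap : rho + eta <= p^-1 by rewrite /eta; lra.
exists (logpow R p^-1 (rho + eta)), (logpow R p^-1 (theta + eta)); split.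
- by apply: Lorentz_logpow => //; rewrite ?rhoE ?lte_fin; lra.
- by apply: Lorentz_logpow => //; rewrite ?thetaE ?lte_fin; lra.
- apply: tensor_logpow_notin b0 bb _ => //; [lra|lra|].
  by rewrite thetaE lte_fin /eta; lra.
Qed.
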